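(* Let $G=(V,E)$ be an $n$-vertex graph in the Congested Clique model, and fix $0<r\le 1$. Let $A$ be an $n^r\times n$ matrix and $B$ an $n\times n$ matrix with entries in $\{1,2,\dots,M\}$, where (viewing $A$ as an $n\times n$ matrix whose last $n-n^r$ rows are zero) each vertex $x\in V$ holds a unique row of $A$ and a unique row of $B$. Let $r'$ be the solution to the equation $r'=1-(1-r)\cdot\omega(r')$. Then for any $R\ge 1$ there is a deterministic algorithm in the Congested Clique that computes a $(1+1/R)$-approximation to $A\star B$ in $O(R\cdot n^{1-2/\omega(r')}\cdot\log M)$ rounds.
   Context: Congested Clique model: the $n$ vertices are processors communicating in synchronous rounds; in each round every pair of vertices may exchange a message of $O(\log n)$ bits; local computation is free; complexity is the number of rounds. For $0\le r\le 1$, $\omega(r)$ denotes the exponent such that the product of an $n^r\times n$ matrix by an $n\times n$ matrix can be computed with $n^{\omega(r)}$ algebraic operations (best known rectangular matrix multiplication). The distance product $C=A\star B$ of an $s\times n$ matrix $A$ and an $n\times q$ matrix $B$ is given by $C_{ij}=\min_{1\le k\le n}\{A_{ik}+B_{kj}\}$. A matrix $C'$ is a $\delta$-approximation to $C$ if $C_{ij}\le C'_{ij}\le\delta\cdot C_{ij}$ for all $i,j$. *)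

(* Defs.v *)
From HB Require Import structures.
From mathcomp Require Import all_boot all_order all_algebra.
From mathcomp Require Import reals exp.

Set Implicit Arguments.
Unset Strict Implicit.
Unset Printing Implicit Defensive.

Import Order.TTheory GRing.Theory Num.Theory.
Local Open Scope ring_scope.

(** Division-free straight-line programs on inputs indexed by [I].
    [Res k] is the result of the [k]-th operation, counted from 0 (and 0 if
    there is none yet).  Reading an input or an integer constant is free, so
    the number of algebraic operations of a program is its size. *)

Inductive ring_op := OpAdd | OpSub | OpMul.

Inductive operand (I : Type) := Var of I | Cst of int | Res of nat.
Arguments Cst {I}.
Arguments Res {I}.

Definition slp (I : Type) := seq (ring_op * operand I * operand I).

Section Evaluation.
Variables (I : Type) (K : comNzRingType) (x : I -> K).

Definition op_val (o : ring_op) (a b : K) : K :=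
  match o with OpAdd => a + b | OpSub => a - b | OpMul => a * b end.

Definition operand_val (res : seq K) (a : operand I) : K :=
  match a with Var i => x i | Cst z => z%:~R | Res k => nth 0 res k end.

Definition slp_results (P : slp I) : seq K :=
  foldl (fun res ins =>
    rcons res (op_val ins.1.1 (operand_val res ins.1.2) (operand_val res ins.2)))
    [::] P.

End Evaluation.

Definition mx_entries (m n p : nat) : Type := (('I_m * 'I_n) + ('I_n * 'I_p))%type.

Definition entry_val (K : Type) (m n p : nat)
    (A : 'M[K]_(m, n)) (B : 'M[K]_(n, p)) (e : mx_entries m n p) : K :=
  match e with inl ij => A ij.1 ij.2 | inr jk => B jk.1 jk.2 end.

Definition computes_mulmx (m n p : nat) (P : slp (mx_entries m n p))
    (out : 'I_m -> 'I_p -> operand (mx_entries m n p)) : Prop :=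
  forall (K : comNzRingType) (A : 'M[K]_(m, n)) (B : 'M[K]_(n, p)) i j,
    operand_val (entry_val A B) (slp_results (entry_val A B) P) (out i j)
    = (A *m B) i j.

(** The integer [n^s], rounded up. *)
Definition npow (R : realType) (n : nat) (s : R) : nat :=
  `|Num.ceil (n%:R `^ s)|%N.

(** An [n^s x n] by [n x n] product takes [O(n^tau)] algebraic operations.
    For [s < 0] the left factor has a single row. *)
Definition rect_mm_exponent (R : realType) (s tau : R) : Prop :=
  exists C : R, forall n : nat, (0 < n)%N ->
    exists (P : slp (mx_entries (npow n s) n n)) out,
      computes_mulmx P out /\ (size P)%:R <= C * n%:R `^ tau.

(** The neutral element of the iterated [minn] is an upper bound of all the
    terms, so for [0 < n] this is their minimum. *)
Definition distprod (m n p : nat) (A : 'M[nat]_(m, n)) (B : 'M[nat]_(n, p)) :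
    'M[nat]_(m, p) :=
  \matrix_(i, j) \big[minn/(\max_(k < n) (A i k + B k j))%N]_(k < n)
    (A i k + B k j)%N.

Definition is_approx (F : realFieldType) (delta : F) (m n : nat)
    (C C' : 'M[F]_(m, n)) : Prop :=
  forall i j, C i j <= C' i j <= delta * C i j.

Definition entries_between (a b m n : nat) (A : 'M[nat]_(m, n)) : Prop :=
  forall i j, (a <= A i j <= b)%N.

(** [A] viewed as an [n x n] matrix, completed by zero rows at the bottom. *)
Definition pad_rows (m n : nat) (A : 'M[nat]_(m, n)) : 'M[nat]_n :=
  \matrix_(i, j) if insub (val i) is Some i' then A i' j else 0%N.

Record sgraph := SGraph {
  vertex : finType;
  edge : rel vertex;
  edge_sym : symmetric edge;
  edge_irrefl : irreflexive edge
}.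

Definition num_vertices (G : sgraph) : nat := #|vertex G|.

(** Deterministic synchronous algorithms on the clique over [V].  In each round
    a vertex sends a (possibly different) bit string to every vertex; local
    computation is unrestricted. *)
Record cc_alg (V : finType) (Inp Out : Type) := CCAlg {
  cc_state : Type;
  cc_init : V -> Inp -> cc_state;
  cc_send : V -> cc_state -> V -> seq bool;
  cc_recv : V -> cc_state -> (V -> seq bool) -> cc_state;
  cc_output : V -> cc_state -> Out
}.

Arguments cc_init {V Inp Out} c _ _.
Arguments cc_send {V Inp Out} c _ _ _.
Arguments cc_recv {V Inp Out} c _ _ _.
Arguments cc_output {V Inp Out} c _ _.

Section Execution.
Variables (V : finType) (Inp Out : Type) (alg : cc_alg V Inp Out).

Definition cc_bandwidth (b : nat) : Prop :=
  forall u s v, (size (cc_send alg u s v) <= b)%N.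

Fixpoint cc_run (inp : V -> Inp) (t : nat) : V -> cc_state alg :=
  match t with
  | 0 => fun v => cc_init alg v (inp v)
  | t'.+1 => fun v =>
      cc_recv alg v (cc_run inp t' v) (fun u => cc_send alg u (cc_run inp t' u) v)
  end.

Definition cc_result (inp : V -> Inp) (t : nat) (v : V) : Out :=
  cc_output alg v (cc_run inp t v).

End Execution.

(** A vertex knows which row of each matrix it holds. *)
Record row_input (n : nat) := RowInput {
  idxA : 'I_n; rowA : 'rV[nat]_n;
  idxB : 'I_n; rowB : 'rV[nat]_n
}.

Definition distribute (V : Type) (n : nat) (A B : 'M[nat]_n)
    (posA posB : V -> 'I_n) (v : V) : row_input n :=
  RowInput (posA v) (row (posA v) A) (posB v) (row (posB v) B).

(* Main.v *)
Require Import Defs.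
From HB Require Import structures.
From mathcomp Require Import all_boot all_order all_algebra.
From mathcomp Require Import reals exp.
From mathcomp Require Import zify ring lra.

Set Implicit Arguments.
Unset Strict Implicit.
Unset Printing Implicit Defensive.

Import Order.TTheory GRing.Theory Num.Theory.
Local Open Scope ring_scope.

(** Over a commutative ring the part of a straight-line program that is bilinear
    in [A] and [B] is a sum of at most twice as many products of linear forms as
    the program has operations.  With [m ~ n^(1/omega(r'))], the equation for
    [r'] makes the blocks of an [m^r' x m] by [m x m] block product at most
    [n/m] on a side, and there are [O(n)] products, [O(1)] per vertex.  The
    linear forms are evaluated entrywise on the blocks: each of the [(n/m)^2]
    offsets in a block is entrusted to a vertex, so that every vertex sends and
    receives [O(n * n/m^2)] words.  A demand known to all vertices is routed
    through intermediate vertices chosen by a greedy edge colouring, in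
    [O(n/m^2) = O(n^(1 - 2/omega(r')))] rounds.

    The distance product is approximated as by Zwick: at each scale [2^t] the
    entries are rounded up to multiples of [2^t/Q], [Q ~ 4 rho]; the monomials
    [x^a] turn a distance product with entries at most [Q] into a polynomial
    matrix product, whose coefficients count indices and may be taken modulo
    [n + 1].  This costs [O(rho)] words per entry for each of the [O(log M)]
    scales. *)

(** * Colouring and encoding *)

Lemma injective_of_card (X Y : finType) :
  (#|X| <= #|Y|)%N -> exists f : X -> Y, injective f.
Proof.
move=> leXY; exists (fun x => enum_val (widen_ord leXY (enum_rank x))) => x y.
by move=> /enum_val_inj/(congr1 val)/= /val_inj/enum_rank_inj.
Qed.

(** All load bounds below are instances of this: the items held by one vertex are counted by a tag
    that tells them apart. *)
Lemma card_fiber_le (X Y V : finType) (f : X -> V) (g : X -> Y) (v : V) :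
  (forall x y, f x = v -> f y = v -> g x = g y -> x = y) ->
  (#|[set x | f x == v]| <= #|Y|)%N.
Proof.
move=> injg; rewrite -(@card_in_imset _ _ g).
  exact: max_card.
by move=> x y; rewrite !inE => /eqP fx /eqP fy; apply: injg.
Qed.

(* Greedy edge colouring of a bipartite multigraph: an edge meets fewer than
   [2 N] others. *)
Lemma edge_coloring (E V Col : finType) (src dst : E -> V) (N : nat) :
  (forall v, #|[set e | src e == v]| <= N)%N ->
  (forall v, #|[set e | dst e == v]| <= N)%N ->
  (2 * N <= #|Col|)%N ->
  exists col : E -> Col, forall e e',
    col e = col e' -> src e = src e' \/ dst e = dst e' -> e = e'.
Proof.
move=> srcN dstN leN.
have Col_gt0 (e : E) : (0 < #|Col|)%N.
  have : (0 < #|[set e' | src e' == src e]|)%N.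
    by apply/card_gt0P; exists e; rewrite inE.
  by have := srcN (src e); lia.
suff [col colP] : exists col : E -> Col, {in enum E &, forall e e',
    col e = col e' -> src e = src e' \/ dst e = dst e' -> e = e'}.
  by exists col => e e'; apply: colP; rewrite mem_enum.
elim: (enum E) (enum_uniq E) => [|x s IH] /=.
  by move=> _; exists (fun e => enum_val (Ordinal (Col_gt0 e))).
case/andP=> xs /IH[col colP].
pose F := [set col e | e in [set e in s | (src e == src x) || (dst e == dst x)]].
have [c cF] : exists c, c \notin F.
  apply/existsP; rewrite -negb_forall; apply/negP => /forallP FT.
  have : (#|Col| <= #|F|)%N by apply/subset_leq_card/subsetP => c _; apply: FT.
  apply/negP; rewrite -ltnNge; apply: leq_trans leN.
  apply: leq_ltn_trans (leq_imset_card _ _) _.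
  have -> : [set e in s | (src e == src x) || (dst e == dst x)] =
      [set e in s | src e == src x] :|: [set e in s | dst e == dst x].
    by apply/setP => e; rewrite !inE andb_orr.
  apply: leq_ltn_trans (leq_card_setU _ _) _.
  (* Strict, because [x] lies in its own fiber but not in [s]; so the two endpoints of [x] together
     forbid fewer than [2 * N] colours. *)
  have lt (f : E -> V) : (forall v, #|[set e | f e == v]| <= N)%N ->
      (#|[set e in s | f e == f x]| < N)%N.
    move=> /(_ (f x)); apply: leq_trans; apply: proper_card.
    apply/properP; split; first by apply/subsetP => e; rewrite !inE => /andP[].
    by exists x; rewrite !inE ?eqxx // negb_and xs.
  by have := lt _ srcN; have := lt _ dstN; lia.
have colx e : e \in s -> col e = c -> src e = src x \/ dst e = dst x -> False.
  move=> es ec sd; move/negP: cF; apply; apply/imsetP; exists e => //.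
  by rewrite !inE es /=; case: sd => ->; rewrite eqxx ?orbT.
exists (fun e => if e == x then c else col e) => e e'.
rewrite !inE; case: eqVneq => [->|ex] /= ; case: eqVneq => [->|ex'] //=.
- by move=> _ es' ec sd; case: (colx e'); [| |case: sd; [left|right]].
- by move=> es _ ec sd; case: (colx e).
- exact: colP.
Qed.

Lemma bitstring_encoding (X : finType) (x0 : X) (b : nat) : (#|X| <= 2 ^ b)%N ->
  exists (enc : X -> seq bool) (dec : seq bool -> X),
    cancel enc dec /\ forall x, (size (enc x) <= b)%N.
Proof.
move=> leX; have [|f injf] := @injective_of_card X (b.-tuple bool).
  by rewrite card_tuple card_bool.
exists (fun x => tval (f x)), (fun s => odflt x0 [pick x | tval (f x) == s]).
split=> [x|x]; last by rewrite size_tuple.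
case: pickP => [y /eqP/val_inj/injf//|/(_ x)]; by rewrite eqxx.
Qed.

(** * Protocols *)

Section Protocols.
Variables (V : finType) (b : nat).

Definition history : Type := seq (V -> seq bool).
(** Messages depend on the whole history instead of an internal state, so that protocols are
    composed by cutting histories. *)
Definition strategy (Inp : Type) : Type :=
  V -> Inp -> history -> V -> seq bool.

Fixpoint received Inp (snd : strategy Inp) (inp : V -> Inp) (t : nat) :
    V -> history :=
  if t is t'.+1 then fun v => rcons (received snd inp t' v)
      (fun u => snd u (inp u) (received snd inp t' u) v)
  else fun=> [::].

Definition computable (Inp Out : Type) (T : nat) (P : (V -> Inp) -> Prop)
    (f : (V -> Inp) -> V -> Out) : Prop :=
  exists (snd : strategy Inp) (out : V -> Inp -> history -> Out),
    (forall u x h v, size (snd u x h v) <= b)%N /\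
    forall inp, P inp -> forall v, out v (inp v) (received snd inp T v) = f inp v.

Lemma size_received Inp (snd : strategy Inp) inp t v :
  size (received snd inp t v) = t.
Proof. by elim: t v => //= t IH v; rewrite size_rcons IH. Qed.

Lemma computable_alg Inp Out T P (f : (V -> Inp) -> V -> Out) :
  computable T P f ->
  exists2 alg : cc_alg V Inp Out, cc_bandwidth alg b &
    forall inp, P inp -> forall v, cc_result alg inp T v = f inp v.
Proof.
case=> snd [out [szb outP]].
pose alg := CCAlg (fun _ x => (x, [::]) : Inp * history)
  (fun u s => snd u s.1 s.2) (fun _ s m => (s.1, rcons s.2 m))
  (fun v s => out v s.1 s.2).
exists alg => [u s v|inp Pinp v]; first exact: szb.
rewrite /cc_result -(outP _ Pinp).
suff run t u : cc_run alg inp t u = (inp u, received snd inp t u).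
  by rewrite run.
elim: t u => //= t IH u; rewrite IH /=; congr (_, rcons _ _).
by apply: boolp.funext => w; rewrite IH.
Qed.

Lemma computable_ext Inp Out T (P : (V -> Inp) -> Prop)
    (f g : (V -> Inp) -> V -> Out) :
  (forall inp, P inp -> f inp =1 g inp) -> computable T P f -> computable T P g.
Proof.
move=> fg [snd [out [szb outP]]]; exists snd, out; split=> // inp Pinp v.
by rewrite outP // fg.
Qed.

Lemma computable_local Inp Out (P : (V -> Inp) -> Prop) (g : V -> Inp -> Out) :
  computable 0 P (fun inp v => g v (inp v)).
Proof. by exists (fun _ _ _ _ => [::]), (fun v x _ => g v x). Qed.

(** The second strategy receives the output computed from the first [T1] entries of the history and
    sees only the later entries, so it runs exactly as on [f inp]. *)
Lemma computable_seq Inp Mid Out T1 T2 (P : (V -> Inp) -> Prop)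
    (Q : (V -> Mid) -> Prop) (f : (V -> Inp) -> V -> Mid)
    (g : (V -> Mid) -> V -> Out) :
  (forall inp, P inp -> Q (f inp)) ->
  computable T1 P f -> computable T2 Q g ->
  computable (T1 + T2) P (fun inp => g (f inp)).
Proof.
move=> PQ [snd1 [out1 [sz1 out1P]]] [snd2 [out2 [sz2 out2P]]].
pose snd u x (h : history) v := if (size h < T1)%N then snd1 u x h v else
  snd2 u (out1 u x (take T1 h)) (drop T1 h) v.
exists snd, (fun v x h => out2 v (out1 v x (take T1 h)) (drop T1 h)).
split=> [u x h v|inp Pinp v]; first by rewrite /snd; case: ifP.
have rec1 t u : (t <= T1)%N -> received snd inp t u = received snd1 inp t u.
  elim: t u => //= t IH u lt; rewrite IH ?(ltnW lt) //; congr rcons.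
  by apply: boolp.funext => w; rewrite IH ?(ltnW lt) // /snd size_received lt.
have rec2 t u : received snd inp (T1 + t) u =
    received snd1 inp T1 u ++ received snd2 (f inp) t u.
  elim: t u => [|t IH] u; first by rewrite addn0 cats0 rec1.
  rewrite addnS /= IH -rcons_cat; congr rcons; apply: boolp.funext => w.
  rewrite IH /snd size_cat !size_received ltnNge leq_addr /=.
  by rewrite take_size_cat ?drop_size_cat ?size_received // out1P.
rewrite rec2 take_size_cat ?drop_size_cat ?size_received // out1P //.
by rewrite out2P //; apply: PQ.
Qed.

Lemma computable_rounds Inp (X : finType) (x0 : X) (P : (V -> Inp) -> Prop) J
    (msg : 'I_J -> V -> Inp -> V -> X) :
  (#|X| <= 2 ^ b)%N ->
  computable J P
    (fun inp v => [ffun ju : 'I_J * V => msg ju.1 ju.2 (inp ju.2) v]).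
Proof.
move=> /(bitstring_encoding x0)[enc [dec [encK szenc]]].
pose bits k u x v : seq bool :=
  if insub k is Some j then enc (msg j u x v) else [::].
pose snd u x (h : history) v := bits (size h) u x v.
exists snd, (fun v x h => [ffun ju => dec (nth (fun=> [::]) h (val ju.1) ju.2)]).
split=> [u x h v|inp _ v]; first by rewrite /snd /bits; case: insubP.
have recE t u : received snd inp t u = mkseq (fun k w => bits k w (inp w) u) t.
  elim: t u => //= t IH u; rewrite IH mkseqS; congr rcons.
  by apply: boolp.funext => w; rewrite IH /snd size_mkseq.
apply/ffunP => -[j u]; rewrite !ffunE recE nth_mkseq ?ltn_ord //=.
by rewrite /bits valK encK.
Qed.

(** One initial round makes all keys common knowledge; the vertices then follow a protocol chosen
    for that assignment of keys. This is what allows routing tables to depend on [k]. *)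
Lemma computable_key Inp Out (X : finType) (x0 : X) (P : (V -> Inp) -> Prop) T
    (key : Inp -> X) (f : (V -> Inp) -> V -> Out) :
  (#|X| <= 2 ^ b)%N ->
  (forall k : V -> X,
     computable T (fun inp => P inp /\ forall v, key (inp v) = k v) f) ->
  computable T.+1 P f.
Proof.
move=> /(bitstring_encoding x0)[enc [dec [encK szenc]]] H.
have /boolp.choice[so soP] : forall k : V -> X, exists so, 
    (forall u x h v, size (so.1 u x h v) <= b)%N /\
    forall inp, P inp /\ (forall v, key (inp v) = k v) ->
    forall v, so.2 v (inp v) (received so.1 inp T v) = f inp v.
  by move=> k; have [snd [out so]] := H k; exists (snd, out).
(* The head of the history carries the keys; its tail is the history of the chosen protocol. *)
pose snd u x (h : history) v :=
  if h is h0 :: h' then (so (dec \o h0)).1 u x h' v else enc (key x).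
exists snd, (fun v x h => if h is h0 :: h' then (so (dec \o h0)).2 v x h'
  else (so (fun=> x0)).2 v x [::]).
split=> [u x [|h0 h] v //=|inp Pinp v]; first by have [] := soP (dec \o h0).
pose k u := key (inp u).
have kE : dec \o (fun u => enc (key (inp u))) = k.
  by apply: boolp.funext => u /=; rewrite encK.
have recE t u : received snd inp t.+1 u =
    (fun w => enc (key (inp w))) :: received (so k).1 inp t u.
  elim: t u => //= t IH u; rewrite IH /=; congr (_ :: rcons _ _).
  by apply: boolp.funext => w; rewrite IH /= kE.
by rewrite recE kE; have [_ ->] := soP k.
Qed.

(** * Placement and routing of data *)

Section Placement.
Variables (K : finType) (k0 : K).
Hypothesis card_K : (#|K| <= 2 ^ b)%N.

(** Values held elsewhere are overwritten by [k0], so that the output at [v] reveals nothing but the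
    items of [v]. *)
Definition localize (X : finType) (loc : X -> V) (s : X -> K) (v : V) :
    {ffun X -> K} := [ffun x => if loc x == v then s x else k0].

(* [placed T P loc val]: after [T] rounds the value of each item [x] is known
   to the vertex [loc x]. *)
Definition placed Inp T (P : (V -> Inp) -> Prop) (X : finType) (loc : X -> V)
    (val : (V -> Inp) -> X -> K) : Prop :=
  computable T P (fun inp => localize loc (val inp)).

(** Items are edges from [loc x] to [loc' x], coloured by pairs of a round and a relay. Each item
    goes to its relay in its round, and in a second phase from the relay to its target. As the
    colouring is proper, no channel carries two items in a round. Each phase lasts [2 * L] rounds,
    since [2 * L * #|V|] colours suffice. *)
Lemma placed_move Inp T P (X : finType) (loc loc' : X -> V)
    (val : (V -> Inp) -> X -> K) (L : nat) :
  (forall v, #|[set x | loc x == v]| <= L * #|V|)%N ->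
  (forall v, #|[set x | loc' x == v]| <= L * #|V|)%N ->
  placed T P loc val -> placed (T + 4 * L) P loc' val.
Proof.
move=> src_le dst_le H.
have [|col colP] := @edge_coloring _ _ ('I_(2 * L) * V)%type loc loc' _
  src_le dst_le.
  by rewrite card_prod card_ord mulnA.
pose msg1 (j : 'I_(2 * L)) u (s : {ffun X -> K}) w :=
  if [pick x | (loc x == u) && (col x == (j, w))] is Some x then s x else k0.
(* The colouring is public, so the relay [w] knows from which vertex it received, in round [j], the
   item due at [v]. *)
pose msg2 (j : 'I_(2 * L)) w (d : {ffun 'I_(2 * L) * V -> K}) v :=
  if [pick x | (loc' x == v) && (col x == (j, w))] is Some x
  then d (j, loc x) else k0.
pose fin v (d : {ffun 'I_(2 * L) * V -> K}) : {ffun X -> K} :=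
  [ffun x => if loc' x == v then d (col x) else k0].
have R1 := computable_rounds k0 (fun=> True) msg1 card_K.
have R2 := computable_rounds k0 (fun=> True) msg2 card_K.
have R3 := computable_local (fun=> True) fin.
have R23 := computable_seq (fun _ _ => I) R2 R3.
have R123 := computable_seq (fun _ _ => I) R1 R23.
have := computable_seq (fun _ _ => I) H R123.
have -> : (T + (2 * L + (2 * L + 0)) = T + 4 * L)%N by lia.
apply: computable_ext => inp _ v; apply/ffunP => x.
rewrite !ffunE; case: eqP => // <-.
case E: (col x) => [j w]; rewrite /= /msg2.
case: pickP => [y /andP[/eqP yx /eqP yc]|/(_ x)]; last by rewrite E !eqxx.
have -> : y = x by apply: colP; [rewrite yc|right].
rewrite ffunE /= /msg1.
case: pickP => [z /andP[/eqP zx /eqP zc]|/(_ x)]; last by rewrite E !eqxx.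
have -> : z = x by apply: colP; [rewrite zc|left].
by rewrite ffunE eqxx.
Qed.

Definition local_rule (X Y : finType) (loc : X -> V) (loc' : Y -> V)
    (F : (X -> K) -> Y -> K) : Prop :=
  forall y s s', (forall x, loc x = loc' y -> s x = s' x) -> F s y = F s' y.

(** By locality the rule gives the same value on the localized items as on all of them, so no
    communication is required. *)
Lemma placed_compute Inp T P (X Y : finType) (loc : X -> V) (loc' : Y -> V)
    (F : (X -> K) -> Y -> K) (val : (V -> Inp) -> X -> K) :
  local_rule loc loc' F ->
  placed T P loc val -> placed T P loc' (fun inp => F (val inp)).
Proof.
move=> Floc H; pose g v (s : {ffun X -> K}) : {ffun Y -> K} :=
  [ffun y => if loc' y == v then F s y else k0].
have := computable_seq (fun _ _ => I) H (computable_local (fun=> True) g).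
rewrite addn0; apply: computable_ext => inp _ v; apply/ffunP => y.
rewrite !ffunE; case: eqP => // <-; apply: Floc => x locx.
by rewrite ffunE locx eqxx.
Qed.

End Placement.
End Protocols.

(** * Bilinear part of a straight-line program *)

Section BilinearPart.
Variables (K : comNzRingType) (m n p : nat).

Definition mxform (a b : nat) (L A : 'M[K]_(a, b)) : K :=
  \sum_i \sum_j L i j * A i j.

Lemma mxformD a b (L L' A : 'M[K]_(a, b)) :
  mxform (L + L') A = mxform L A + mxform L' A.
Proof.
rewrite /mxform -big_split; apply: eq_bigr => i _; rewrite -big_split /=.
by apply: eq_bigr => j _; rewrite mxE mulrDl.
Qed.

Lemma mxformZ a b c (L A : 'M[K]_(a, b)) :
  mxform (c *: L) A = c * mxform L A.
Proof.
rewrite /mxform mulr_sumr; apply: eq_bigr => i _; rewrite mulr_sumr.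
by apply: eq_bigr => j _; rewrite mxE mulrA.
Qed.

Lemma mxform0 a b (A : 'M[K]_(a, b)) : mxform 0 A = 0.
Proof. by rewrite -(scale0r 0) mxformZ mul0r. Qed.

Lemma mxform_delta a b i j (A : 'M[K]_(a, b)) : mxform (delta_mx i j) A = A i j.
Proof.
rewrite /mxform (bigD1 i) //= (bigD1 j) //= !mxE !eqxx mul1r.
rewrite !big1 ?addr0 // => [i' /negPf ii'|j' /negPf jj'].
  by rewrite big1 // => j' _; rewrite mxE ii' mul0r.
by rewrite mxE jj' andbF mul0r.
Qed.

(** A pair holds the coefficient matrices of a linear form in [A] and of one in [B]; it stands for
    the product of their values. *)
Definition products := seq ('M[K]_(m, n) * 'M[K]_(n, p)).

Definition bilinear_sum (s : products) (g : nat -> K) A B : K :=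
  \sum_(w < size s) g w * (mxform (nth 0 s w).1 A * mxform (nth 0 s w).2 B).

Definition in_span (s : products) (Q : 'M[K]_(m, n) -> 'M[K]_(n, p) -> K) :=
  exists g, forall A B, Q A B = bilinear_sum s g A B.

Lemma in_span0 s : in_span s (fun _ _ => 0).
Proof.
by exists (fun=> 0) => A B; rewrite /bilinear_sum big1 // => w _; rewrite mul0r.
Qed.

Lemma in_spanD s Q Q' : in_span s Q -> in_span s Q' ->
  in_span s (fun A B => Q A B + Q' A B).
Proof.
move=> [g gP] [g' gP']; exists (fun w => g w + g' w) => A B.
rewrite gP gP' /bilinear_sum -big_split; apply: eq_bigr => w _ /=.
by rewrite -mulrDl.
Qed.

Lemma in_spanZ s c Q : in_span s Q -> in_span s (fun A B => c * Q A B).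
Proof.
move=> [g gP]; exists (fun w => c * g w) => A B.
rewrite gP /bilinear_sum mulr_sumr; apply: eq_bigr => w _ /=.
by rewrite -mulrA.
Qed.

Lemma in_span_cat s s' Q : in_span s Q -> in_span (s ++ s') Q.
Proof.
move=> [g gP]; exists (fun w => if (w < size s)%N then g w else 0) => A B.
rewrite gP /bilinear_sum size_cat big_split_ord /= [X in _ + X]big1 ?addr0.
  by apply: eq_bigr => w _; rewrite nth_cat ltn_ord.
by move=> w _; rewrite ltnNge leq_addr mul0r.
Qed.

Lemma in_span_mem s x : x \in s ->
  in_span s (fun A B => mxform x.1 A * mxform x.2 B).
Proof.
move=> xs; exists (fun w => (w == index x s)%:R) => A B.
rewrite /bilinear_sum; have lt : (index x s < size s)%N by rewrite index_mem.
rewrite (bigD1 (Ordinal lt)) //= eqxx mul1r nth_index // big1 ?addr0 //.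
by move=> w; rewrite -val_eqE /= => /negPf->; rewrite mul0r.
Qed.

(* Programs are run over [K[Y][X]] on the inputs [A * X] and [B * Y]; the
   coefficient of [X Y] of a value is its part bilinear in [A] and [B]. *)
Definition lift_entries (A : 'M[K]_(m, n)) (B : 'M[K]_(n, p)) :
    mx_entries m n p -> {poly {poly K}} :=
  entry_val (map_mx (fun x => x%:P%:P * 'X) A)
            (map_mx (fun x => (x%:P * 'X)%:P) B).

(** Only the four coefficients of degree at most 1 in [X] and in [Y] have to be tracked: those of a
    sum, difference or product are determined by those of the operands. *)
Definition tame (s : products)
    (F : 'M[K]_(m, n) -> 'M[K]_(n, p) -> {poly {poly K}}) : Prop :=
  exists (c : K) (a : 'M[K]_(m, n)) (b : 'M[K]_(n, p)),
    [/\ forall A B, (F A B)`_0`_0 = c,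
        forall A B, (F A B)`_1`_0 = mxform a A,
        forall A B, (F A B)`_0`_1 = mxform b B
      & in_span s (fun A B => (F A B)`_1`_1)].

Lemma tame_const s (z : int) : tame s (fun _ _ => z%:~R).
Proof.
exists z%:~R, 0, 0.
have E k l : (z%:~R : {poly {poly K}})`_k`_l =
    if (k == 0%N) && (l == 0%N) then z%:~R else 0.
  have -> : z%:~R = (z%:~R : K)%:P%:P by rewrite !rmorph_int.
  by rewrite coefC; case: k => [|k] /=; rewrite ?coef0 // coefC.
split=> [A B|A B|A B|]; rewrite ?E ?mxform0 //.
by have [g gP] := in_span0 s; exists g => A B; rewrite -gP.
Qed.

Lemma tame_var s e : tame s (fun A B => lift_entries A B e).
Proof.
case: e => -[i j] /=.
- exists 0, (delta_mx i j), 0.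
  have E A B k l : (lift_entries A B (inl (i, j)))`_k`_l =
      if (k == 1%N) && (l == 0%N) then A i j else 0.
    rewrite /lift_entries /= mxE coefMX; case: k => [|[|k]] /=; rewrite ?coef0 //.
      by rewrite coefC /= coefC; case: l.
    by rewrite coefC /= coef0.
  split=> [A B|A B|A B|]; rewrite ?E ?mxform0 ?mxform_delta //.
  by have [g gP] := in_span0 s; exists g => A B; rewrite -gP E.
- exists 0, 0, (delta_mx i j).
  have E A B k l : (lift_entries A B (inr (i, j)))`_k`_l =
      if (k == 0%N) && (l == 1%N) then B i j else 0.
    rewrite /lift_entries /= mxE coefC; case: k => [|k] /=; rewrite ?coef0 //.
    by rewrite coefMX coefC; case: l => [|[|l]].
  split=> [A B|A B|A B|]; rewrite ?E ?mxform0 ?mxform_delta //.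
  by have [g gP] := in_span0 s; exists g => A B; rewrite -gP E.
Qed.

Lemma tame_cat s s' F : tame s F -> tame (s ++ s') F.
Proof.
by case=> c [a [b [Fc Fa Fb Q]]]; exists c, a, b; split=> //; apply: in_span_cat.
Qed.

(** With [x] equal to 1 or -1 this covers addition and subtraction, neither of which creates a
    product. *)
Lemma tame_linear s F G (x : K) : tame s F -> tame s G ->
  tame s (fun A B => F A B + x%:P%:P * G A B).
Proof.
move=> [c [a [b [Fc Fa Fb FQ]]]] [c' [a' [b' [Gc Ga Gb GQ]]]].
exists (c + x * c'), (a + x *: a'), (b + x *: b').
have E A B k l : (F A B + x%:P%:P * G A B)`_k`_l =
    (F A B)`_k`_l + x * (G A B)`_k`_l by rewrite coefD coefCM coefD coefCM.
split=> [A B|A B|A B|]; rewrite ?E ?mxformD ?mxformZ ?Fc ?Fa ?Fb ?Gc ?Ga ?Gb //.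
have [g gP] := in_spanD FQ (in_spanZ x GQ).
by exists g => A B; rewrite -gP E.
Qed.

(** The coefficient of [X Y] in the product is [c Q' + c' Q + a b' + a' b], where [Q] and [Q'] are
    those of [F] and [G]; only the last two terms are new products. *)
Lemma tame_mul s F G : tame s F -> tame s G ->
  exists2 s' : products, size s' = 2%N &
    tame (s ++ s') (fun A B => F A B * G A B).
Proof.
move=> [c [a [b [Fc Fa Fb FQ]]]] [c' [a' [b' [Gc Ga Gb GQ]]]].
exists [:: (a, b'); (a', b)] => //; set s' := [:: _; _].
have E0 (u v : {poly {poly K}}) : (u * v)`_0 = u`_0 * v`_0.
  by rewrite coefM big_ord1.
have E0' (u v : {poly K}) : (u * v)`_0 = u`_0 * v`_0.
  by rewrite coefM big_ord1.
have E1 (u v : {poly {poly K}}) : (u * v)`_1 = u`_0 * v`_1 + u`_1 * v`_0.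
  by rewrite coefM big_ord_recl big_ord1.
have E1' (u v : {poly K}) : (u * v)`_1 = u`_0 * v`_1 + u`_1 * v`_0.
  by rewrite coefM big_ord_recl big_ord1.
exists (c * c'), (c *: a' + c' *: a), (c *: b' + c' *: b).
split=> [A B|A B|A B|].
- by rewrite E0 E0' Fc Gc.
- by rewrite E1 coefD !E0' Fc Gc Fa Ga mxformD !mxformZ [c' * _]mulrC.
- by rewrite E0 E1' Fc Gc Fb Gb mxformD !mxformZ [c' * _]mulrC.
have m1 : (a, b') \in s ++ s' by rewrite mem_cat !inE eqxx orbT.
have m2 : (a', b) \in s ++ s' by rewrite mem_cat !inE eqxx !orbT.
have [g gP] := in_spanD
  (in_spanD (in_spanZ c (in_span_cat s' GQ)) (in_spanZ c' (in_span_cat s' FQ)))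
  (in_spanD (in_span_mem m1) (in_span_mem m2)).
exists g => A B; rewrite -gP E1 coefD !E1' Fc Gc Fa Ga Fb Gb /=; ring.
Qed.

Lemma tame_ext s F G : (forall A B, F A B = G A B) -> tame s F -> tame s G.
Proof.
by move=> FG; have -> // : F = G by apply: boolp.funext => A; apply: boolp.funext.
Qed.

Lemma slp_results_rcons (I : Type) (L : comNzRingType) (x : I -> L) P ins :
  slp_results x (rcons P ins) = rcons (slp_results x P)
    (op_val ins.1.1 (operand_val x (slp_results x P) ins.1.2)
                    (operand_val x (slp_results x P) ins.2)).
Proof. by rewrite /slp_results foldl_rcons. Qed.

Lemma tame_op s o F G : tame s F -> tame s G ->
  exists2 s' : products, (size s' <= 2)%N &
    tame (s ++ s') (fun A B => op_val o (F A B) (G A B)).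
Proof.
move=> tF tG; case: o => /=.
- exists [::] => //; rewrite cats0.
  by apply: tame_ext (tame_linear 1 tF tG) => A B; rewrite !polyC1 mul1r.
- exists [::] => //; rewrite cats0.
  apply: tame_ext (tame_linear (-1) tF tG) => A B.
  by rewrite !polyCN !polyC1 mulN1r.
- by have [s' sz ts'] := tame_mul tF tG; exists s'; rewrite ?sz.
Qed.

Lemma slp_tame (P : slp (mx_entries m n p)) :
  exists2 s : products, (size s <= 2 * size P)%N &
    forall a, tame s (fun A B =>
      operand_val (lift_entries A B) (slp_results (lift_entries A B) P) a).
Proof.
suff [s sz sP] : exists2 s : products, (size s <= 2 * size P)%N &
    forall k, tame s (fun A B => nth 0 (slp_results (lift_entries A B) P) k).
  exists s => // -[e|z|k] /=; [exact: tame_var|exact: tame_const|exact: sP].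
elim/last_ind: P => [|P ins [s sz sP]].
  exists [::] => // k; apply: tame_ext (tame_const _ 0) => A B.
  by rewrite nth_nil.
have sPa a : tame s (fun A B =>
    operand_val (lift_entries A B) (slp_results (lift_entries A B) P) a).
  case: a => [e|z|k] /=; [exact: tame_var|exact: tame_const|exact: sP].
have [s' sz' ts'] := tame_op ins.1.1 (sPa ins.1.2) (sPa ins.2).
exists (s ++ s') => [|k]; first by rewrite size_cat size_rcons; lia.
have szr A B : size (slp_results (lift_entries A B) P) = size P.
  elim/last_ind: (P) => // P' i IH.
  by rewrite slp_results_rcons !size_rcons IH.
(* Respectively an earlier result, a result not yet available, which reads as 0, and the result of
   the last operation. *)
case: (ltngtP k (size P)) => ks.
- apply: tame_ext (tame_cat s' (sP k)) => A B.
  by rewrite slp_results_rcons nth_rcons szr ks.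
- apply: tame_ext (tame_const _ 0) => A B; rewrite nth_default //.
  by rewrite slp_results_rcons size_rcons szr.
- apply: tame_ext ts' => A B.
  by rewrite slp_results_rcons nth_rcons szr ks ltnn eqxx.
Qed.

(** The program is correct over every commutative ring, hence over [K[Y][X]], where it multiplies
    [A X] by [B Y]; the coefficient of [X Y] in an output is the entry of [A *m B]. *)
Lemma bilinear_of_slp (P : slp (mx_entries m n p)) out :
  computes_mulmx P out ->
  exists2 s : products, (size s <= 2 * size P)%N &
    exists g : 'I_m -> 'I_p -> nat -> K, forall A B i j,
      (A *m B) i j = bilinear_sum s (g i j) A B.
Proof.
move=> Pok; have [s sz sP] := slp_tame P; exists s => //.
suff H (ij : 'I_m * 'I_p) : exists g : nat -> K, forall A B,
    (A *m B) ij.1 ij.2 = bilinear_sum s g A B.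
  have [g gP] := boolp.choice H; exists (fun i j => g (i, j)) => A B i j.
  by rewrite -gP.
case: ij => i j /=; have [c [a [b [_ _ _ [g gP]]]]] := sP (out i j).
exists g => A B; rewrite -gP /lift_entries Pok !mxE !coef_sum.
apply: eq_bigr => k _; rewrite !mxE mulrAC coefMX /= -!polyCM coefC /=.
by rewrite mulrA coefMX -polyCM coefC.
Qed.

End BilinearPart.

(* Over a finite ring the second factors of the products determine [B]. *)
Lemma bilinear_rank_ge (K : finComNzRingType) (a m : nat) (s : products K a m m)
    (g : 'I_a -> 'I_m -> nat -> K) :
  (0 < a)%N ->
  (forall A B i j, (A *m B) i j = bilinear_sum s (g i j) A B) ->
  (m * m <= size s)%N.
Proof.
case: a s g => // a s g _ sP.
pose F (B : 'M[K]_m) : {ffun 'I_(size s) -> K} :=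
  [ffun w => mxform (nth 0 s (val w)).2 B].
have Finj : injective F.
  move=> B B' FB; apply/matrixP => k j.
  (* A left factor with a single 1 in its first row extracts any entry of the right factor, so the
     values of the second forms determine [B]. *)
  have rE (C : 'M[K]_m) : C k j = (delta_mx ord0 k *m C) (ord0 : 'I_a.+1) j.
    rewrite mxE (bigD1 k) //= mxE !eqxx mul1r big1 ?addr0 // => k' /negPf kk'.
    by rewrite mxE kk' mul0r.
  rewrite !rE !sP; apply: eq_bigr => w _; congr (_ * (_ * _)).
  by have /ffunP/(_ w) := FB; rewrite !ffunE.
have := leq_card F Finj; rewrite card_ffun card_mx card_ord.
rewrite leq_exp2l //; exact: card_finNzRing_gt1.
Qed.

(** * Distributed block product *)

(** Each index below [m * h] is uniquely [k * h + q], and the indices from [n] on contribute 0. *)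
Lemma sum_interleave (K : comNzRingType) (n m h : nat) (F : nat -> K) :
  (n <= m * h)%N -> (forall x, (n <= x)%N -> F x = 0) ->
  \sum_(q < h) \sum_(k < m) F (k * h + q)%N = \sum_(x < n) F x.
Proof.
move=> le_n F0; rewrite exchange_big /=.
transitivity (\sum_(0 <= x < m * h) F x).
  rewrite big_nat_mul -(big_mkord xpredT (fun k => \sum_(q < h) F (k * h + q)%N)).
  apply: eq_big_nat => k _.
  rewrite -[in RHS](add0n (k * h)%N) big_addn mulSn addnK.
  by rewrite big_mkord; apply: eq_bigr => q _; rewrite addnC.
rewrite (big_cat_nat _ le_n) //= big_mkord [X in _ + X]big_nat_cond.
rewrite [X in _ + X]big1 ?addr0 //.
by move=> x /andP[/andP[/F0]].
Qed.

Lemma pair_eq (A B : Type) (x y : A * B) : x.1 = y.1 -> x.2 = y.2 -> x = y.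
Proof. by case: x y => [? ?] [? ?] /= -> ->. Qed.

Section DistributedProduct.
Variables (V : finType) (b : nat) (K : finComNzRingType) (Lay : finType).
Variable conv : Lay -> Lay -> Lay -> bool.
Let n := #|V|.
Variables (a m h D c : nat) (s : products K a m m).
Variable coef : 'I_a -> 'I_m -> nat -> K.
Hypothesis card_K : (#|K| <= 2 ^ b)%N.
Hypothesis h_gt0 : (0 < h)%N.
Hypothesis le_n_mh : (n <= m * h)%N.
Hypothesis le_m2 : (m * m <= n)%N.
Hypothesis le_h2 : (h * h <= D * n)%N.
Hypothesis le_s : (size s <= c * n)%N.
Hypotheses (D_gt0 : (0 < D)%N) (c_gt0 : (0 < c)%N).
Hypothesis sP :
  forall A B i j, (A *m B) i j = bilinear_sum s (coef i j) A B.
Variables holdA holdB : 'I_n -> V.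
Hypotheses (holdA_inj : injective holdA) (holdB_inj : injective holdB).

Variable off : 'I_h * 'I_h -> V * 'I_D.
Hypothesis off_inj : injective off.
Variable wrk : 'I_(size s) -> V * 'I_c.
Hypothesis wrk_inj : injective wrk.

(** * Block indices, places of the data and loads *)

Notation offset := ('I_h * 'I_h)%type.
Notation worker := ('I_(size s)).
Notation entries := ('I_n * 'I_n)%type.

(** An index is split into a block number, its quotient by [h], and an offset, its remainder. [off]
    entrusts pairs of offsets to vertices, at most [D] to each, and [wrk] distributes the products,
    at most [c] to each. *)
Definition rem_h (i : 'I_n) : 'I_h := Ordinal (ltn_pmod i h_gt0).

Lemma quo_h_subproof (i : 'I_n) : (i %/ h < m)%N.
Proof. by rewrite ltn_divLR //; apply: leq_trans (ltn_ord i) le_n_mh. Qed.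

Definition quo_h (i : 'I_n) : 'I_m := Ordinal (quo_h_subproof i).

Lemma rem_quo_inj (i j : 'I_n) :
  (i %% h = j %% h)%N -> (i %/ h = j %/ h)%N -> i = j.
Proof.
by move=> er eq; apply: val_inj; rewrite /= (divn_eq i h) er eq -divn_eq.
Qed.

(* Items are tagged with [true] for the left factor and [false] for the right
   one. *)
Definition at_holder (x : bool * entries * Lay) : V :=
  if x.1.1 then holdA x.1.2.1 else holdB x.1.2.1.
Definition at_offset (x : bool * entries * Lay) : V :=
  (off (rem_h x.1.2.1, rem_h x.1.2.2)).1.
Definition form_at_offset (x : bool * (offset * worker) * Lay) : V :=
  (off x.1.2.1).1.
Definition form_at_worker (x : bool * (offset * worker) * Lay) : V :=
  (wrk x.1.2.2).1.
Definition prod_at_worker (x : (offset * worker) * Lay) : V := (wrk x.1.2).1.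
Definition prod_at_offset (x : (offset * worker) * Lay) : V := (off x.1.1).1.
Definition res_at_offset (x : entries * Lay) : V :=
  (off (rem_h x.1.1, rem_h x.1.2)).1.
Definition res_at_holder (x : entries * Lay) : V := holdA x.1.1.

(** A common bound for all placements, in units of [n] items per vertex; the 2 accounts for the two
    factors of the matrix product. *)
Definition load : nat := 2 * (c * D * #|Lay|).

Lemma load_bound2 x : (x <= c * (D * n))%N -> (2 * x * #|Lay| <= load * n)%N.
Proof.
move=> le_x; rewrite -mulnA.
apply: leq_trans (leq_mul (leqnn 2) (leq_mul le_x (leqnn _))) _.
by rewrite /load -!mulnA !leq_mul2l [(n * _)%N]mulnC leqnn !orbT.
Qed.

Lemma load_bound1 x : (x <= c * (D * n))%N -> (x * #|Lay| <= load * n)%N.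
Proof.
by move=> le_x; apply: leq_trans (load_bound2 le_x); rewrite -mulnA leq_pmull.
Qed.

Lemma le_n_load : (n <= c * (D * n))%N.
Proof. by rewrite mulnA leq_pmull // muln_gt0 c_gt0. Qed.

Lemma le_m2_load : (m * m * D <= c * (D * n))%N.
Proof.
by rewrite mulnC; apply: leq_trans (leq_mul (leqnn D) le_m2) (leq_pmull _ _).
Qed.

Lemma le_h2_load : (h * h * c <= c * (D * n))%N.
Proof. by rewrite mulnC leq_mul2l le_h2 orbT. Qed.

Lemma le_s_load : (D * size s <= c * (D * n))%N.
Proof. by rewrite mulnCA leq_mul2l le_s orbT. Qed.

Lemma load_at_holder v : (#|[set x | at_holder x == v]| <= load * n)%N.
Proof.
apply: leq_trans (@card_fiber_le _ (bool * 'I_n * Lay)%type _ _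
  (fun x => (x.1.1, x.1.2.2, x.2)) _ _) _.
  move=> [[[] [i j]] l] [[[] [i' j']] l'] //=; rewrite /at_holder /= => <-.
    by move/holdA_inj=> -> [-> ->].
  by move/holdB_inj=> -> [-> ->].
by rewrite !card_prod card_bool card_ord; apply/load_bound2/le_n_load.
Qed.

(** The vertex and the slot in ['I_D] recover the two remainders by [off_inj], and the quotients
    then recover both indices. The bounds that follow use the same kind of tag. *)
Lemma load_at_offset v : (#|[set x | at_offset x == v]| <= load * n)%N.
Proof.
apply: leq_trans (@card_fiber_le _ (bool * ('I_m * 'I_m * 'I_D) * Lay)%type _ _
  (fun x => (x.1.1, (quo_h x.1.2.1, quo_h x.1.2.2,
     (off (rem_h x.1.2.1, rem_h x.1.2.2)).2), x.2)) _ _) _.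
  move=> [[e [i j]] l] [[e' [i' j']] l'] /= fx fy [<- q1 q2 o <-].
  have /off_inj[r1 r2] : off (rem_h i, rem_h j) = off (rem_h i', rem_h j').
    by apply: pair_eq => //; rewrite -[RHS]fy in fx.
  by rewrite (rem_quo_inj r1 q1) (rem_quo_inj r2 q2).
by rewrite !card_prod card_bool !card_ord; apply/load_bound2/le_m2_load.
Qed.

Lemma load_form_at_offset v : (#|[set x | form_at_offset x == v]| <= load * n)%N.
Proof.
apply: leq_trans (@card_fiber_le _ (bool * ('I_D * worker) * Lay)%type _ _
  (fun x => (x.1.1, ((off x.1.2.1).2, x.1.2.2), x.2)) _ _) _.
  move=> [[e [o w]] l] [[e' [o' w']] l'] /= fx fy [<- eo <- <-].
  have /off_inj-> // : off o = off o'.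
  by apply: pair_eq; rewrite // -[RHS]fy in fx.
by rewrite !card_prod card_bool !card_ord; apply/load_bound2/le_s_load.
Qed.

Lemma load_form_at_worker v : (#|[set x | form_at_worker x == v]| <= load * n)%N.
Proof.
apply: leq_trans (@card_fiber_le _ (bool * (offset * 'I_c) * Lay)%type _ _
  (fun x => (x.1.1, (x.1.2.1, (wrk x.1.2.2).2), x.2)) _ _) _.
  move=> [[e [o w]] l] [[e' [o' w']] l'] /= fx fy [<- <- ew <-].
  have /wrk_inj-> // : wrk w = wrk w'.
  by apply: pair_eq; rewrite // -[RHS]fy in fx.
by rewrite !card_prod card_bool !card_ord; apply/load_bound2/le_h2_load.
Qed.

Lemma load_prod_at_worker v : (#|[set x | prod_at_worker x == v]| <= load * n)%N.
Proof.
apply: leq_trans (@card_fiber_le _ (offset * 'I_c * Lay)%type _ _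
  (fun x => (x.1.1, (wrk x.1.2).2, x.2)) _ _) _.
  move=> [[o w] l] [[o' w'] l'] /= fx fy [<- ew <-].
  have /wrk_inj-> // : wrk w = wrk w'.
  by apply: pair_eq; rewrite // -[RHS]fy in fx.
by rewrite !card_prod !card_ord; apply/load_bound1/le_h2_load.
Qed.

Lemma load_prod_at_offset v : (#|[set x | prod_at_offset x == v]| <= load * n)%N.
Proof.
apply: leq_trans (@card_fiber_le _ ('I_D * worker * Lay)%type _ _
  (fun x => ((off x.1.1).2, x.1.2, x.2)) _ _) _.
  move=> [[o w] l] [[o' w'] l'] /= fx fy [eo <- <-].
  have /off_inj-> // : off o = off o'.
  by apply: pair_eq; rewrite // -[RHS]fy in fx.
by rewrite !card_prod !card_ord; apply/load_bound1/le_s_load.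
Qed.

Lemma load_res_at_offset v : (#|[set x | res_at_offset x == v]| <= load * n)%N.
Proof.
apply: leq_trans (@card_fiber_le _ ('I_m * 'I_m * 'I_D * Lay)%type _ _
  (fun x => (quo_h x.1.1, quo_h x.1.2,
     (off (rem_h x.1.1, rem_h x.1.2)).2, x.2)) _ _) _.
  move=> [[i j] l] [[i' j'] l'] /= fx fy [q1 q2 o <-].
  have /off_inj[r1 r2] : off (rem_h i, rem_h j) = off (rem_h i', rem_h j').
    by apply: pair_eq => //; rewrite -[RHS]fy in fx.
  by rewrite (rem_quo_inj r1 q1) (rem_quo_inj r2 q2).
by rewrite !card_prod !card_ord; apply/load_bound1/le_m2_load.
Qed.

Lemma load_res_at_holder v : (#|[set x | res_at_holder x == v]| <= load * n)%N.
Proof.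
apply: leq_trans (@card_fiber_le _ ('I_n * Lay)%type _ _
  (fun x => (x.1.2, x.2)) _ _) _.
  move=> [[i j] l] [[i' j'] l']; rewrite /res_at_holder /= => <-.
  by move/holdA_inj=> -> [-> ->].
by rewrite !card_prod !card_ord; apply/load_bound1/le_n_load.
Qed.

(** * Local computations of the block product *)

Definition get (t : bool * entries * Lay -> K) (e : bool) (x y : nat) (l : Lay) :
    K :=
  if insub x is Some i then if insub y is Some j then t (e, (i, j), l) else 0
  else 0.

(** For a fixed offset, the entries found there in all blocks form one small matrix, padded with
    zeros by [get]. The number [r] of block rows is [a] for the left factor and [m] for the right
    one. *)
Definition block (r : nat) (t : bool * entries * Lay -> K) e (o : offset) l :
    'M[K]_(r, m) :=
  \matrix_(I, J) get t e (I * h + o.1)%N (J * h + o.2)%N l.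

Definition forms (t : bool * entries * Lay -> K)
    (y : bool * (offset * worker) * Lay) : K :=
  let w := nth 0 s (val y.1.2.2) in
  if y.1.1 then mxform w.1 (block a t true y.1.2.1 y.2)
  else mxform w.2 (block m t false y.1.2.1 y.2).

(** At a worker, the forms over all offsets make up one [h x h] matrix per factor and layer. The
    worker multiplies these matrices, [q] being the inner index, and adds up the pairs of layers
    that contribute to the layer [y.2]. *)
Definition local_products (t : bool * (offset * worker) * Lay -> K)
    (y : (offset * worker) * Lay) : K :=
  \sum_l1 \sum_(l2 | conv y.2 l1 l2) \sum_q
    t (true, ((y.1.1.1, q), y.1.2), l1) * t (false, ((q, y.1.1.2), y.1.2), l2).

Definition results (t : (offset * worker) * Lay -> K) (y : entries * Lay) : K :=
  if (insub (y.1.1 %/ h)%N : option 'I_a) is Some k then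
    \sum_w coef k (quo_h y.1.2) (val w) * t ((rem_h y.1.1, rem_h y.1.2), w, y.2)
  else 0.

Lemma block_local r t t' e (o : offset) l :
  (forall x, at_offset x = (off o).1 -> t x = t' x) ->
  block r t e o l = block r t' e o l.
Proof.
move=> tt'; apply/matrixP => I J; rewrite !mxE /get.
case: insubP => // i _ iE; case: insubP => // j _ jE; apply: tt'.
rewrite /at_offset /=; congr (off _).1; case: o iE jE => p q /= iE jE.
by congr (_, _); apply: val_inj; rewrite /= ?iE ?jE modnMDl modn_small.
Qed.

Lemma forms_local : local_rule at_offset form_at_offset forms.
Proof.
move=> [[e [o w]] l] t t' tt'; rewrite /forms /=.
by case: e tt' => tt'; congr (mxform _ _); apply: block_local.
Qed.

Lemma local_products_local :
  local_rule form_at_worker prod_at_worker local_products.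
Proof.
move=> [[o w] l] t t' tt'; do 3!(apply: eq_bigr => ? _).
by congr (_ * _); apply: tt'.
Qed.

Lemma results_local : local_rule prod_at_offset res_at_offset results.
Proof.
move=> [[i j] l] t t' tt'; rewrite /results; case: insub => // I.
by apply: eq_bigr => w _; congr (_ * _); apply: tt'.
Qed.

Lemma resultsE (A B : Lay -> 'M[K]_n) t (i j : 'I_n) l :
  (forall i j l, t (true, (i, j), l) = A l i j) ->
  (forall i j l, t (false, (i, j), l) = B l i j) ->
  (i < a * h)%N ->
  results (local_products (forms t)) ((i, j), l) =
  \sum_l1 \sum_(l2 | conv l l1 l2) (A l1 *m B l2) i j.
Proof.
move=> tA tB lt_i; rewrite /results /=.
case: insubP => [I _ IE|]; last by rewrite ltn_divLR // lt_i.
under eq_bigr do rewrite /local_products mulr_sumr.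
rewrite exchange_big; apply: eq_bigr => l1 _ /=.
under eq_bigr do rewrite mulr_sumr.
rewrite exchange_big; apply: eq_bigr => l2 _ /=.
under eq_bigr do rewrite mulr_sumr.
rewrite exchange_big /=.
(* For fixed layers and inner offset, [sP] recognises the sum over the workers as an entry of a
   product of two small matrices. *)
under eq_bigr => q _ do rewrite -/(bilinear_sum s (coef I (quo_h j))
  (block a t true (rem_h i, q) l1) (block m t false (q, rem_h j) l2)) -sP mxE.
pose F x := get t true i x l1 * get t false x j l2.
rewrite [RHS]mxE; transitivity (\sum_(x < n) F x); last first.
  by apply: eq_bigr => x _; rewrite /F /get !valK tA tB.
rewrite -(sum_interleave (m := m) (h := h)) //; last first.
  by move=> x nx; rewrite /F /get valK insubN -?leqNgt // mul0r.
by do 2!(apply: eq_bigr => ? _); rewrite !mxE /= IE -!divn_eq.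
Qed.

(** Four moves of [4 * load] rounds each, holder to offset, offset to worker and back, then to the
    holder, alternate with three local computations. *)
Lemma distributed_product Inp T (P : (V -> Inp) -> Prop)
    (A B : (V -> Inp) -> Lay -> 'M[K]_n) :
  placed b 0 T P at_holder (fun inp x =>
    if x.1.1 then A inp x.2 x.1.2.1 x.1.2.2 else B inp x.2 x.1.2.1 x.1.2.2) ->
  placed b 0 (T + 16 * load) P res_at_holder (fun inp x =>
    if (x.1.1 < a * h)%N then
      \sum_l1 \sum_(l2 | conv x.2 l1 l2) (A inp l1 *m B inp l2) x.1.1 x.1.2
    else 0).
Proof.
move/(placed_move card_K load_at_holder load_at_offset).
move/(placed_compute forms_local).
move/(placed_move card_K load_form_at_offset load_form_at_worker).
move/(placed_compute local_products_local).
move/(placed_move card_K load_prod_at_worker load_prod_at_offset).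
move/(placed_compute results_local).
move/(placed_move card_K load_res_at_offset load_res_at_holder).
have -> : (T + 4 * load + 4 * load + 4 * load + 4 * load = T + 16 * load)%N.
  by lia.
apply: computable_ext => inp _ v; apply/ffunP => -[[i j] l]; rewrite !ffunE /=.
case: ifP => // _; case: ifP => lt_i; first exact: resultsE.
(* From row [a * h] on, the block number is at least [a] and [results] takes its default value 0. *)
by rewrite /results insubN // -leqNgt leq_divRL // leqNgt lt_i.
Qed.

End DistributedProduct.

(** * Scaling *)

Lemma distprod_le (m n p : nat) (A : 'M[nat]_(m, n)) (B : 'M[nat]_(n, p)) i j k :
  (distprod A B i j <= A i k + B k j)%N.
Proof. by rewrite mxE -minEnat; apply: (@bigmin_le _ nat). Qed.

Lemma distprod_attained (m n p : nat) (A : 'M[nat]_(m, n)) (B : 'M[nat]_(n, p))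
    i j : (0 < n)%N -> exists k, distprod A B i j = (A i k + B k j)%N.
Proof.
case: n A B => // n A B _; rewrite mxE -minEnat.
have [] := @eq_bigmin _ nat _ (\max_(k < n.+1) (A i k + B k j))%N ord0 predT
  (fun k => A i k + B k j)%N isT.
  by move=> k _; apply: (@leq_bigmax _ (fun k => A i k + B k j)%N).
by move=> k _ e; exists k.
Qed.

Section Scaling.
Variables (Q tau : nat).
Hypothesis Q_gt0 : (0 < Q)%N.

(* [ceil (Q x / 2^t)] *)
Definition scaled (t x : nat) : nat := (Q * x + (2 ^ t).-1) %/ 2 ^ t.

Lemma scaled_ge t x : (Q * x <= scaled t x * 2 ^ t)%N.
Proof.
rewrite /scaled; have p : (0 < 2 ^ t)%N by rewrite expn_gt0.
have := divn_eq (Q * x + (2 ^ t).-1) (2 ^ t).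
by have := ltn_pmod (Q * x + (2 ^ t).-1) p; lia.
Qed.

Lemma scaled_lt t x : (scaled t x * 2 ^ t < Q * x + 2 ^ t)%N.
Proof.
rewrite /scaled; have p : (0 < 2 ^ t)%N by rewrite expn_gt0.
by have := divn_eq (Q * x + (2 ^ t).-1) (2 ^ t); lia.
Qed.

Lemma scaled_le t x : (x <= 2 ^ t)%N -> (scaled t x <= Q)%N.
Proof.
move=> le_x; have := scaled_lt t x; have p : (0 < 2 ^ t)%N by rewrite expn_gt0.
move=> lt_s; rewrite -ltnS -(ltn_pmul2r p); apply: leq_trans lt_s _.
by rewrite mulSn addnC leq_add2l leq_mul2l le_x orbT.
Qed.

(** A scale and an exponent; at its scale a scaled entry is at most [Q], so a sum of two is at most
    [2 * Q]. *)
Definition layer : finType := ('I_tau * 'I_(2 * Q).+1)%type.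

Definition in_layer (l : layer) (x : nat) : bool :=
  (x <= 2 ^ l.1)%N && (scaled l.1 x == l.2).

(** Multiplication of monomials: exponents add, within one scale. *)
Definition layer_conv (l l1 l2 : layer) : bool :=
  [&& l1.1 == l.1, l2.1 == l.1 & (l1.2 + l2.2 == l.2)%N].

Definition in_sum_layer (l : layer) (x y : nat) : bool :=
  [&& (x <= 2 ^ l.1)%N, (y <= 2 ^ l.1)%N
    & (scaled l.1 x + scaled l.1 y == l.2)%N].

(** At a given scale a number lies in at most one layer, so at most one term of the double sum is
    nonzero. *)
Lemma sum_layers (K : comNzRingType) (l : layer) (x y : nat) :
  \sum_l1 \sum_(l2 | layer_conv l l1 l2) (in_layer l1 x)%:R * (in_layer l2 y)%:R
  = (in_sum_layer l x y)%:R :> K.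
Proof.
(* The only layer at the scale of [l] that can contain [z]; [inord] does not truncate when
   [z <= 2 ^ l.1]. *)
pose at_l z : layer := (l.1, inord (scaled l.1 z)).
have only l1 z : l1.1 = l.1 -> in_layer l1 z -> l1 = at_l z.
  case: l1 => t c /= -> /andP[_ /eqP/= sE]; congr (_, _); apply: val_inj.
  by rewrite /= inordK sE.
have atE z : (z <= 2 ^ l.1)%N -> val (at_l z).2 = scaled l.1 z.
  move=> /scaled_le le_s.
  by rewrite /= inordK // ltnS (leq_trans le_s) // leq_pmull.
have at_in z : (z <= 2 ^ l.1)%N -> in_layer (at_l z) z.
  by move=> le_z; rewrite /in_layer atE //= le_z eqxx.
case: (boolP (in_sum_layer l x y)) => [/and3P[le_x le_y /eqP sE]|hit].
  rewrite (bigD1 (at_l x)) //= [X in _ + X]big1 => [|l1 nl1]; last first.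
    apply: big1 => l2 /and3P[/eqP e1 _ _].
    case: (boolP (in_layer l1 x)) => [/(only _ _ e1) e|_]; last by rewrite mul0r.
    by rewrite e eqxx in nl1.
  rewrite (bigD1 (at_l y)) /=; last first.
    by rewrite /layer_conv !atE // sE !eqxx.
  rewrite !at_in // mul1r big1 ?addr0 // => l2 /andP[/and3P[_ /eqP e2 _] nl2].
  case: (boolP (in_layer l2 y)) => [/(only _ _ e2) e|_]; last by rewrite mulr0.
  by rewrite e eqxx in nl2.
apply: big1 => l1 _; apply: big1 => l2 /and3P[/eqP e1 /eqP e2 /eqP e3].
rewrite -natrM mulnb; case: andP => // -[/andP[x1 /eqP x2] /andP[y1 /eqP y2]].
case/negP: hit.
by rewrite /in_sum_layer -{1}e1 -{1}e2 x1 y1 /= -{1}e1 x2 -e2 y2 e3.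
Qed.

Definition layer_value (l : layer) : rat := (2 ^ l.1 * l.2)%:R / Q%:R.

Lemma layer_value_ge (l : layer) x y :
  in_sum_layer l x y -> (x + y)%:R <= layer_value l.
Proof.
case/and3P=> _ _ /eqP sE; rewrite /layer_value ler_pdivlMr ?ltr0n //.
rewrite -natrM ler_nat -sE; have := scaled_ge l.1 x; have := scaled_ge l.1 y; lia.
Qed.

Lemma layer_value_lt (l : layer) x y : in_sum_layer l x y ->
  layer_value l <= (x + y)%:R + (2 * 2 ^ l.1)%:R / Q%:R.
Proof.
case/and3P=> _ _ /eqP sE; rewrite /layer_value ler_pdivrMr ?ltr0n //.
rewrite mulrDl divfK ?pnatr_eq0 -?lt0n // -natrM -natrD ler_nat -sE.
by have := scaled_lt l.1 x; have := scaled_lt l.1 y; lia.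
Qed.

(** The scale is the least [t] with [maxn x y <= 2 ^ t], so [2 ^ t] is at most twice the maximum. *)
Lemma good_scale (M x y : nat) : (up_log 2 M < tau)%N ->
  (0 < x <= M)%N -> (0 < y <= M)%N ->
  exists l : layer, in_sum_layer l x y /\ (2 ^ l.1 <= 2 * (x + y))%N.
Proof.
move=> lt_tau /andP[x0 xM] /andP[y0 yM]; pose z := maxn x y.
have zM : (up_log 2 z < tau)%N.
  by apply: leq_ltn_trans lt_tau; apply: leq_up_log; rewrite geq_max xM.
have zt : (z <= 2 ^ up_log 2 z)%N by apply: up_logP.
have lt2 : (2 ^ up_log 2 z <= 2 * z)%N.
  case: (ltnP 1 z) => z1; last first.
    by have -> : z = 1%N by rewrite /z in z1 *; lia.
  have := up_log_gtn (ltnSn 1) z1.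
  have : (0 < up_log 2 z)%N by rewrite up_log_gt0 z1.
  by case: (up_log 2 z) => // k _ /=; rewrite expnS; lia.
have xt : (x <= 2 ^ up_log 2 z)%N by apply: leq_trans zt; rewrite leq_maxl.
have yt : (y <= 2 ^ up_log 2 z)%N by apply: leq_trans zt; rewrite leq_maxr.
exists (Ordinal zM, inord (scaled (up_log 2 z) x + scaled (up_log 2 z) y)).
split; last by rewrite /=; rewrite /z in lt2 *; lia.
rewrite /in_sum_layer /= xt yt /= inordK ?eqxx //.
by have := scaled_le xt; have := scaled_le yt; lia.
Qed.

(** Rounding up never goes below a true sum, and [2 * M] bounds them all, whence the lower bound.
    For the upper bound, the minimising [k] at its good scale [t] incurs an error of at most
    [2 * 2 ^ t / Q <= 4 d / Q <= d / rho]. *)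
Lemma scaled_min_approx (R : realType) (rho : R) (M m n p : nat)
    (A : 'M[nat]_(m, n)) (B : 'M[nat]_(n, p)) i j (S : pred layer) :
  1 <= rho -> 4 * rho <= Q%:R -> (up_log 2 M < tau)%N -> (0 < n)%N ->
  entries_between 1 M A -> entries_between 1 M B ->
  (forall l, S l = [exists k, in_sum_layer l (A i k) (B k j)]) ->
  ((distprod A B i j)%:R : R)
    <= ratr (\big[Num.min/(2 * M)%:R]_(l | S l) layer_value l)
    <= (1 + 1 / rho) * (distprod A B i j)%:R.
Proof.
move=> rho1 leQ lt_tau n_gt0 hA hB SE.
have [k kE] := distprod_attained A B i j n_gt0.
have := hA i k; have := hB k j; move: (distprod_le A B i j) kE.
set d := distprod A B i j; move=> d_le kE hBk hAk; apply/andP; split.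
  rewrite -[d%:R]ratr_nat ler_rat le_bigmin //.
    by rewrite ler_nat kE; lia.
  move=> l; rewrite SE => /existsP[k' /layer_value_ge]; apply: le_trans.
  by rewrite ler_nat.
have [l [hit le2]] := good_scale lt_tau hAk hBk.
have Sl : S l by rewrite SE; apply/existsP; exists k.
apply: le_trans (_ : ratr (layer_value l) <= _).
  by rewrite ler_rat; apply: (@bigmin_le_cond _ rat).
have le_v : ratr (layer_value l) <= ratr (d%:R + (2 * 2 ^ l.1)%:R / Q%:R) :> R.
  by rewrite ler_rat kE; apply: layer_value_lt.
apply: le_trans le_v _.
rewrite rmorphD rmorphM /= fmorphV /= !ratr_nat mulrDl mul1r lerD2l mul1r.
have rho0 : 0 < rho by apply: lt_le_trans rho1.
have Q0 : 0 < Q%:R :> R by rewrite ltr0n.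
rewrite ler_pdivrMr // -mulrA [rho^-1 * _]mulrC ler_pdivlMr //.
have le2R : (2 ^ l.1)%:R <= 2 * d%:R :> R by rewrite -natrM ler_nat kE.
have d0 : 0 <= d%:R :> R by rewrite ler0n.
rewrite natrM; nra.
Qed.

End Scaling.

(** * Exponents *)

Section Exponents.
Variable R : realType.

Lemma powRD_gt0 (x s t : R) : 0 < x -> x `^ (s + t) = x `^ s * x `^ t.
Proof. by move=> x0; rewrite powRD // (gt_eqF x0) implybT. Qed.

Lemma npow_ge (n : nat) (s : R) : n%:R `^ s <= (npow n s)%:R.
Proof.
rewrite /npow natr_absz ger0_norm ?ceil_ge // ceil_ge0.
by apply: lt_le_trans (powR_ge0 _ _); lra.
Qed.

Lemma npow_le (n k : nat) (s : R) : n%:R `^ s <= k%:R -> (npow n s <= k)%N.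
Proof.
move=> le_k; rewrite -lez_nat /npow gez0_abs ?ceil_le_int // ceil_ge0.
by apply: lt_le_trans (powR_ge0 _ _); lra.
Qed.

Lemma npow_gt0 (n : nat) (s : R) : (0 < n)%N -> (0 < npow n s)%N.
Proof.
move=> n0; rewrite -(ltr0n R); apply: lt_le_trans (npow_ge _ _).
by rewrite powR_gt0 // ltr0n.
Qed.

(** Over ['F_2] a program for size [m] yields at least [m * m] products, so [m ^ (2 - tau)] stays
    below [2 * C]; for [tau < 2] this fails when [m] is large. *)
Lemma rect_mm_exponent_ge2 (s tau : R) : rect_mm_exponent s tau -> 2 <= tau.
Proof.
case=> C HC; rewrite leNgt; apply/negP => lt2.
have le2 (m : nat) : (0 < m)%N -> m%:R `^ (2 - tau) <= 2 * C.
  move=> m0; have [P [out [Pok szP]]] := HC m m0.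
  have [l szl [g gP]] := bilinear_of_slp 'F_2 Pok.
  have := bilinear_rank_ge (npow_gt0 s m0) gP.
  move=> /leq_trans/(_ szl); rewrite -(ler_nat R) !natrM => le_m.
  have m0R : 0 < m%:R :> R by rewrite ltr0n.
  have pm := powR_gt0 tau m0R.
  rewrite -(ler_pM2r pm) -powRD_gt0 //.
  rewrite subrK powR_mulrn ?ler0n // expr2.
  by apply: le_trans le_m _; rewrite -mulrA ler_pM2l.
(* Chosen so that [x ^ (2 - tau)] is [2 * C + 1], just above the bound. *)
pose x := (2 * C + 1) `^ (2 - tau)^-1; pose m := (Num.trunc x).+1.
have C0 : 0 <= 2 * C by have := le2 1%N isT; apply: le_trans; apply: powR_ge0.
have lt_x : x <= m%:R by apply: ltW; rewrite -truncn_le_nat.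
have d0 : 0 < 2 - tau by rewrite subr_gt0.
have := le2 m isT; apply/negP; rewrite -ltNge.
apply: lt_le_trans (_ : x `^ (2 - tau) <= _).
  by rewrite /x -powRrM mulVf ?gt_eqF // powRr1; lra.
by apply: ge0_ler_powR => //; rewrite ?ltW // nnegrE ?powR_ge0 ?ler0n.
Qed.

(** [m] is [n ^ (1 / om)] rounded down, [a] is [m ^ r'] rounded up, and [h] and [D] slightly exceed
    [n / m] and [h * h / n]. That [m * m <= n] rests on [2 <= om]. *)
Lemma mm_parameters (r r' om : R) :
  rect_mm_exponent r' om -> r <= 1 -> r' = 1 - (1 - r) * om ->
  exists2 c : nat, (0 < c)%N &
  forall (n : nat) (K : finComNzRingType), (0 < n)%N ->
  exists (a m h D : nat) (s : products K a m m) (g : 'I_a -> 'I_m -> nat -> K),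
  [/\ [/\ (0 < h)%N, (n <= m * h)%N & (npow n r <= a * h)%N],
      [/\ (m * m <= n)%N, (h * h <= D * n)%N, (0 < D)%N & (size s <= c * n)%N],
      forall A B i j, (A *m B) i j = bilinear_sum s (g i j) A B
    & D%:R <= 20 * n%:R `^ (1 - 2 / om)].
Proof.
move=> H r1 r'E; have om2 := rect_mm_exponent_ge2 H; case: H => C HC.
have om0 : 0 < om by lra.
(* There are at most [2 * size P] products, and [m ^ om <= n]. *)
exists (Num.trunc (2 * `|C|)).+1 => // n K n0.
have nR1 : 1 <= n%:R :> R by rewrite ler1n.
have nR0 : 0 < n%:R :> R by rewrite ltr0n.
pose x : R := n%:R `^ om^-1; pose m := Num.trunc x.
have x1 : 1 <= x by rewrite -(powRr0 n%:R) /x ler_powR // invr_ge0 ltW.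
have m0 : (0 < m)%N by rewrite truncn_gt0.
have le_mx : m%:R <= x by rewrite -truncn_ge_nat //; lra.
have lt_xm : x < m.+1%:R by rewrite -truncn_le_nat.
have mR1 : 1 <= m%:R :> R by rewrite ler1n.
have mR0 : 0 < m%:R :> R by rewrite ltr0n.
have xom : x `^ om = n%:R by rewrite /x -powRrM mulVf ?gt_eqF // powRr1 // ltW.
have mom : m%:R `^ om <= n%:R.
  by rewrite -xom; apply: ge0_ler_powR; rewrite ?nnegrE //; lra.
have m2 : (m * m <= n)%N.
  rewrite -(ler_nat R) natrM -expr2 -powR_mulrn ?ler0n //.
  by apply: le_trans mom; apply: ler_powR.
have mn : (m <= n)%N by apply: leq_trans m2; rewrite leq_pmull.
have [P [out [Pok szP]]] := HC m m0.
have [s szs [g gP]] := bilinear_of_slp K Pok.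
pose h := (n %/ m).+1; pose D := ((h * h) %/ n).+1.
have hm : (n <= m * h)%N by rewrite mulnC ltnW // ltn_ceil.
have hm2 : (h * m <= 2 * n)%N.
  by rewrite /h mulSn mul2n -addnn leq_add // leq_trunc_div.
have hD : (h * h <= D * n)%N by rewrite ltnW // ltn_ceil.
have Dh : (D * n <= h * h + n)%N.
  by rewrite /D mulSn addnC leq_add2r leq_trunc_div.
exists (npow m r'), m, h, D, s, g; split=> //; [split=> //|split=> //|].
(* The equation for [r'] enters here: [m = m ^ ((1 - r) om) m ^ r' <= n ^ (1 - r) m ^ r'], so
   [n ^ r m <= n m ^ r' <= m h a]. *)
- apply: npow_le; rewrite natrM -(ler_pM2r mR0).
  have mE : m%:R = m%:R `^ ((1 - r) * om) * m%:R `^ r' :> R.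
    rewrite -powRD_gt0 // r'E.
    by rewrite addrC subrK powRr1 // ltW.
  rewrite {1}mE mulrA.
  apply: le_trans (_ : n%:R * m%:R `^ r' <= _).
    apply: ler_wpM2r; first exact: powR_ge0.
    apply: le_trans (_ : n%:R `^ r * n%:R `^ (1 - r) <= _).
      apply: ler_wpM2l; first exact: powR_ge0.
      rewrite mulrC powRrM; apply: ge0_ler_powR; rewrite ?nnegrE ?powR_ge0 //.
      by lra.
    rewrite -powRD_gt0 //.
    by rewrite addrC subrK powRr1 // ltW.
  apply: le_trans (_ : (m * h)%:R * (npow m r')%:R <= _).
    by apply: ler_pM; rewrite ?powR_ge0 ?ler0n ?ler_nat ?npow_ge.
  by rewrite natrM; lra.
- rewrite -(ler_nat R); apply: le_trans (_ : (2 * size P)%:R <= _).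
    by rewrite ler_nat.
  rewrite natrM; apply: le_trans (_ : 2 * `|C| * m%:R `^ om <= _).
    rewrite -mulrA ler_pM2l //; apply: le_trans szP _.
    by apply: ler_wpM2r; rewrite ?powR_ge0 ?ler_norm.
  rewrite natrM; apply: ler_pM => //; rewrite ?powR_ge0 ?mulr_ge0 //.
  by apply: ltW; rewrite -truncn_le_nat.
- have x2 : n%:R `^ (1 - 2 / om) * x ^+ 2 = n%:R.
    rewrite -powR_mulrn; last by lra.
    rewrite /x -powRrM [om^-1 * _]mulrC -powRD_gt0 //.
    by rewrite subrK powRr1 // ltW.
  have x20 : 0 < x ^+ 2 by rewrite exprn_gt0 //; lra.
  rewrite -(ler_pM2r x20) -mulrA x2.
  have xm2 : x ^+ 2 <= 4 * m%:R ^+ 2.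
    have xm : x <= 2 * m%:R by move: lt_xm; rewrite -natr1; lra.
    by rewrite (_ : 4 * _ = (2 * m%:R) ^+ 2); [rewrite lerXn2r ?nnegrE; lra|ring].
  apply: le_trans (_ : D%:R * (4 * m%:R ^+ 2) <= _).
    by apply: ler_wpM2l; rewrite ?ler0n.
  (* From [D n <= h h + n], [h m <= 2 n] and [m m <= n]; the bound [x <= 2 m] costs another factor
     4, which gives 20. *)
  have : (D * m * m <= 5 * n)%N.
    rewrite -(leq_pmul2r n0); apply: leq_trans (_ : (h * h + n) * (m * m) <= _)%N.
      rewrite (_ : D * m * m * n = D * n * (m * m))%N; last by ring.
      by rewrite leq_mul2r Dh orbT.
    rewrite mulnDl mulnACA.
    rewrite (_ : 5 * n * n = 2 * n * (2 * n) + n * n)%N; last by ring.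
    by apply: leq_add; apply: leq_mul.
  by rewrite -(ler_nat R) !natrM expr2 => Dm; lra.
Qed.

End Exponents.

(** * Approximate distance product *)

(** The global matrix is recovered from the inputs of all vertices, so that the target of the
    algorithm is a function of the inputs; a row held by nobody reads as 0. *)
Definition row_matrix (V : finType) (n : nat) (idx : row_input n -> 'I_n)
    (rw : row_input n -> 'rV[nat]_n) (inp : V -> row_input n) : 'M[nat]_n :=
  \matrix_(i, j)
    if [pick v | idx (inp v) == i] is Some v then rw (inp v) 0 j else 0%N.

Lemma row_matrixE (V : finType) n idx rw (inp : V -> row_input n) v j :
  injective (fun v => idx (inp v)) ->
  row_matrix idx rw inp (idx (inp v)) j = rw (inp v) 0 j.
Proof.
move=> inj; rewrite mxE; case: pickP => [u /eqP/inj->//|/(_ v)].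
by rewrite eqxx.
Qed.

Section ApproximateRows.
Variables (n M Q tau N : nat).
Hypothesis n_gt1 : (1 < n)%N.
Hypothesis Q_gt0 : (0 < Q)%N.

Definition layer_mx (l : layer Q tau) (A : 'M[nat]_n) : 'M['Z_n.+1]_n :=
  map_mx (fun x => (in_layer l x)%:R) A.

Definition layer_count (A B : 'M[nat]_n) (l : layer Q tau) (i j : 'I_n) :
    'Z_n.+1 :=
  if (i < N)%N then
    \sum_l1 \sum_(l2 | layer_conv l l1 l2) (layer_mx l1 A *m layer_mx l2 B) i j
  else 0.

(** The default [2 * M] is at least any sum of two entries bounded by [M], hence never below the
    distance. *)
Definition approx_row (A B : 'M[nat]_n) (i : 'I_n) : 'rV[rat]_n :=
  \row_j \big[Num.min/(2 * M)%:R]_(l | layer_count A B l i j != 0) layer_value l.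

(* The modulus [n + 1] exceeds the number of indices [k]. *)
Lemma layer_count_neq0 A B l (i j : 'I_n) : (i < N)%N ->
  (layer_count A B l i j != 0) = [exists k, in_sum_layer l (A i k) (B k j)].
Proof.
move=> ltN; rewrite /layer_count ltN.
have -> : \sum_l1 \sum_(l2 | layer_conv l l1 l2)
    (layer_mx l1 A *m layer_mx l2 B) i j =
    (\sum_k in_sum_layer l (A i k) (B k j))%N%:R.
  rewrite natr_sum.
  under [RHS]eq_bigr do rewrite -sum_layers //.
  rewrite [RHS]exchange_big; apply: eq_bigr => l1 _ /=.
  rewrite [RHS]exchange_big; apply: eq_bigr => l2 _ /=.
  by rewrite mxE; apply: eq_bigr => k _; rewrite !mxE.
set S := (\sum_k _)%N.
have le_S : (S <= n)%N.
  rewrite -[n in (_ <= n)%N]card_ord -sum1_card; apply: leq_sum => k _.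
  exact: leq_b1.
rewrite -val_eqE /= val_Zp_nat ?modn_small ?ltnS //; last by lia.
rewrite sum_nat_eq0 negb_forall; apply: eq_existsb => k.
by rewrite eqb0 negbK.
Qed.

End ApproximateRows.

(** * The algorithm for fixed parameters *)

Section Algorithm.
Variables (V : finType) (b M Q tau : nat).
Let n := #|V|.
Hypothesis n_gt1 : (1 < n)%N.
Hypothesis le_b : (n * n <= 2 ^ b)%N.
Variables (a m h D c : nat) (s : products 'Z_n.+1 a m m).
Variable coef : 'I_a -> 'I_m -> nat -> 'Z_n.+1.
Hypothesis h_gt0 : (0 < h)%N.
Hypothesis le_n_mh : (n <= m * h)%N.
Hypothesis le_m2 : (m * m <= n)%N.
Hypothesis le_h2 : (h * h <= D * n)%N.
Hypothesis le_s : (size s <= c * n)%N.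
Hypotheses (D_gt0 : (0 < D)%N) (c_gt0 : (0 < c)%N).
Hypothesis sP :
  forall A B i j, (A *m B) i j = bilinear_sum s (coef i j) A B.

(** The one additional round announces which rows each vertex holds, after which the routing is
    common knowledge. All layers are handled in a single block product, and the minimum is taken
    locally. *)
Lemma computable_approx_row :
  computable b (16 * load (layer Q tau) D c).+1
    (fun inp : V -> row_input n => injective (fun v => idxA (inp v)) /\
                                  injective (fun v => idxB (inp v)))
    (fun inp v => approx_row M Q tau (a * h) (row_matrix (@idxA n) (@rowA n) inp)
       (row_matrix (@idxB n) (@rowB n) inp) (idxA (inp v))).
Proof.
have n_gt0 : (0 < n)%N by apply: ltnW.
have i0 : 'I_n := Ordinal n_gt0.
have card_K : (#|'Z_n.+1| <= 2 ^ b)%N.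
  apply: leq_trans le_b; rewrite card_ord Zp_cast //; nia.
apply: (@computable_key _ _ _ _ ('I_n * 'I_n)%type (i0, i0) _ _
  (fun x => (idxA x, idxB x))); first by rewrite card_prod card_ord.
move=> k; pose posA v := (k v).1; pose posB v := (k v).2.
set P := fun inp => _ /\ _.
have PE inp : P inp ->
    (forall v, idxA (inp v) = posA v) /\ (forall v, idxB (inp v) = posB v).
  by case=> _ e; split=> v; rewrite /posA /posB -e.
(* An announced assignment that is not injective comes from no admissible input, so any protocol
   serves. *)
case: (boolP (injectiveb posA && injectiveb posB)); last first.
  move=> ninj; exists (fun _ _ _ _ => [::]), (fun _ _ _ => 0).
  split=> // inp Pinp.
  have [eA eB] := PE _ Pinp; case: Pinp => -[iA iB] _; case/negP: ninj.
  apply/andP; split; apply/injectiveP => u v; rewrite -?eA -?eB.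
    exact: iA.
  exact: iB.
case/andP=> /injectiveP injA /injectiveP injB.
have [holdA posAK holdAK] := inj_card_bij injA (eq_leq (card_ord n)).
have [holdB posBK holdBK] := inj_card_bij injB (eq_leq (card_ord n)).
have [|off off_inj] := @injective_of_card ('I_h * 'I_h)%type (V * 'I_D)%type.
  by rewrite !card_prod !card_ord [(#|V| * _)%N]mulnC.
have [|wrk wrk_inj] := @injective_of_card 'I_(size s) (V * 'I_c)%type.
  by rewrite card_prod !card_ord mulnC.
pose Ain inp := row_matrix (@idxA n) (@rowA n) (inp : V -> row_input n).
pose Bin inp := row_matrix (@idxB n) (@rowB n) (inp : V -> row_input n).
(* No round is spent: the holder of a row computes the indicators of its entries in all layers. *)
have H0 : placed b 0 0%N P (at_holder (Lay := layer Q tau) holdA holdB)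
    (fun inp x =>
    if x.1.1 then layer_mx x.2 (Ain inp) x.1.2.1 x.1.2.2
    else layer_mx x.2 (Bin inp) x.1.2.1 x.1.2.2).
  pose init v (x : row_input n) :
      {ffun bool * ('I_n * 'I_n) * layer Q tau -> 'Z_n.+1} :=
    [ffun y => if at_holder holdA holdB y == v then
       (in_layer y.2 (if y.1.1 then rowA x 0 y.1.2.2 else rowB x 0 y.1.2.2))%:R
     else 0].
  apply: computable_ext (computable_local b P init) => inp Pinp v.
  have [eA eB] := PE _ Pinp; have [[iA iB] _] := Pinp.
  apply/ffunP => -[[e [i j]] l]; rewrite !ffunE; case: eqP => //= ev.
  case: e ev => /= <-; rewrite /layer_mx mxE /at_holder /=.
    by rewrite -{2}(holdAK i) -eA row_matrixE.
  by rewrite -{2}(holdBK i) -eB row_matrixE.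
pose AL inp l := layer_mx (l : layer Q tau) (Ain inp).
pose BL inp l := layer_mx (l : layer Q tau) (Bin inp).
have H1 := @distributed_product _ _ _ _ (@layer_conv Q tau) _ _ _ _ _ _ _ card_K
  h_gt0 le_n_mh le_m2 le_h2 le_s D_gt0 c_gt0 sP _ _ (can_inj holdAK)
  (can_inj holdBK) _ off_inj _ wrk_inj _ _ _ AL BL H0.
pose fin v (y : {ffun ('I_n * 'I_n) * layer Q tau -> 'Z_n.+1}) : 'rV[rat]_n :=
  \row_j \big[Num.min/(2 * M)%:R]_(l | y (posA v, j, l) != 0) layer_value l.
have := computable_seq (fun _ _ => I) H1 (computable_local b (fun=> True) fin).
rewrite add0n addn0; apply: computable_ext => inp Pinp v.
have [eA eB] := PE _ Pinp.
apply/rowP => j; rewrite !mxE; apply: eq_bigl => l.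
by rewrite ffunE /res_at_holder /= posAK eqxx eA.
Qed.

End Algorithm.

(** * Number of scales, and assembly of the result *)

Lemma scale_count_le (R : realType) (M : nat) : (1 < M)%N ->
  (up_log 2 M).+1%:R * ln 2 <= 3 * ln M%:R :> R.
Proof.
move=> M1; have := up_log_gtn (ltnSn 1) M1.
have : (0 < up_log 2 M)%N by rewrite up_log_gt0 M1.
(* Now [up_log 2 M] is [u + 1] with [2 ^ u < M]; the two units beyond [u] are paid by
   [ln 2 <= ln M]. *)
case: (up_log 2 M) => // u _ ltM.
have M0 : (0 < M)%N by apply: ltnW.
have l2 : ln 2 <= ln M%:R :> R by rewrite ler_ln ?posrE ?ltr0n // ler_nat.
have lu : u%:R * ln 2 <= ln M%:R :> R.
  rewrite mulr_natl -lnXn // -natrX ler_ln ?posrE ?ltr0n ?expn_gt0 //.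
  by rewrite ler_nat; apply: ltnW ltM.
have -> : u.+2%:R = u%:R + 2 :> R by rewrite -addn2 natrD.
by lra.
Qed.

Lemma is_approx_map (R : realType) (delta : R) (m n : nat) (C : 'M[nat]_(m, n))
    (C' : 'M[rat]_(m, n)) :
  (forall i j, ((C i j)%:R : R) <= ratr (C' i j) <= delta * (C i j)%:R) ->
  is_approx delta (map_mx (fun k : nat => k%:R) C) (map_mx ratr C').
Proof. by move=> H i j; rewrite !mxE. Qed.

Lemma pad_rowsE (m n : nat) (A : 'M[nat]_(m, n)) (i : 'I_m) (i' : 'I_n) j :
  nat_of_ord i' = i -> pad_rows A i' j = A i j.
Proof. by move=> e; rewrite mxE /= e valK. Qed.

Lemma row_matrix_distribute (V : finType) (n : nat) (A B : 'M[nat]_n)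
    (posA posB : V -> 'I_n) : bijective posA -> bijective posB ->
  row_matrix (@idxA n) (@rowA n) (distribute A B posA posB) = A /\
  row_matrix (@idxB n) (@rowB n) (distribute A B posA posB) = B.
Proof.
move=> bA bB; have [holdA _ holdAK] := bA; have [holdB _ holdBK] := bB.
split; apply/matrixP => i j.
  have := @row_matrixE V n (@idxA n) (@rowA n) (distribute A B posA posB)
    (holdA i) j (bij_inj bA).
  by rewrite /= holdAK [X in _ = X]mxE.
have := @row_matrixE V n (@idxB n) (@rowB n) (distribute A B posA posB)
    (holdB i) j (bij_inj bB).
by rewrite /= holdBK [X in _ = X]mxE.
Qed.

Theorem theorem4 (R : realType) (omega : R -> R) (r r' : R)
  (homega : forall s : R, s <= 1 -> rect_mm_exponent s (omega s))
  (hr : 0 < r <= 1)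
  (hr' : r' <= 1)
  (hsol : r' = 1 - (1 - r) * omega r') :
  exists (c : nat) (K : R),
  forall (G : sgraph) (M : nat) (rho : R), 1 <= rho ->
  let n := num_vertices G in
  exists (alg : cc_alg (vertex G) (row_input n) 'rV[rat]_n) (T : nat),
  [/\ cc_bandwidth alg (c * up_log 2 n),
      T%:R <= K * (rho * n%:R `^ (1 - 2 / omega r') * ln M%:R)
    & forall (A : 'M[nat]_(npow n r, n)) (B : 'M[nat]_n)
             (posA posB : vertex G -> 'I_n),
        bijective posA -> bijective posB ->
        entries_between 1 M A -> entries_between 1 M B ->
        exists2 C' : 'M[rat]_(npow n r, n),
          is_approx (1 + 1 / rho)
            (map_mx (fun k : nat => k%:R) (distprod A B)) (map_mx ratr C')
        & forall (v : vertex G) (i : 'I_(npow n r)),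
            nat_of_ord (posA v) = nat_of_ord i ->
            cc_result alg (distribute (pad_rows A) B posA posB) T v
            = row i C'].
Proof.
have /andP[r0 r1] := hr.
have [c c0 cP] := mm_parameters (homega r' hr') r1 hsol.
have ln2 : 0 < ln 2 :> R by rewrite ln_gt0 // ltr1n.
(* 33 from [16 * 2 * W + 1 <= 33 * W], [c] and 20 from the parameters, 11 from
   [2 * Q + 1 <= 11 * rho], and [3 / ln 2] from the number of scales. *)
pose K : R := 33 * c%:R * 20 * 11 * 3 / ln 2.
have K0 : 0 <= K by rewrite /K !mulr_ge0 ?invr_ge0 ?ler0n // ltW.
(* [2 * up_log 2 n] bits hold a pair of row indices and, for [n > 1], a residue modulo [n + 1]. *)
exists 2%N, K => G M rho rho1 n.
have rho0 : 0 < rho by lra.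
have lnM0 : 0 <= ln M%:R :> R.
  by case: (M) => [|k]; [rewrite ln0|rewrite ln_ge0 // ler1n].
have bound0 : 0%:R <= K * (rho * n%:R `^ (1 - 2 / omega r') * ln M%:R).
  apply: mulr_ge0 => //; apply: mulr_ge0 => //.
  by apply: mulr_ge0; [apply: ltW|apply: powR_ge0].
have exact_ok (d : nat) : (d%:R : R) <= ratr d%:R <= (1 + 1 / rho) * d%:R.
  rewrite ratr_nat lexx mulrDl mul1r lerDl mulr_ge0 ?ler0n //.
  by apply: divr_ge0 => //; apply: ltW.
pose local0 (g : row_input n -> 'rV[rat]_n) :=
  computable_alg (computable_local (2 * up_log 2 n) (fun=> True)
    (fun _ : vertex G => g)).
(* Here [ln M] is 0 and no round is allowed; all entries being 1, every distance is 2. *)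
case: (leqP M 1) => M1.
  have [alg algb algP] := local0 (fun=> const_mx 2).
  exists alg, 0%N; split=> // A B posA posB _ _ hA hB.
  exists (const_mx 2) => [|v i _]; last by rewrite algP // row_const.
  apply: is_approx_map => i j.
  have [k kE] := distprod_attained A B i j (leq_ltn_trans (leq0n _) (ltn_ord j)).
  have -> : distprod A B i j = 2%N by have := hA i k; have := hB k j; lia.
  rewrite [const_mx _ _ _]mxE.
  exact: exact_ok.
(* Here the bandwidth is 0, but a lone vertex holds both matrices and there is a single index. *)
case: (leqP n 1) => n1.
  have [alg algb algP] := local0 (fun x => \row_j (rowA x 0 j + rowB x 0 j)%:R).
  exists alg, 0%N; split=> // A B posA posB _ _ hA hB.
  have eq_ord (i j : 'I_n) : i = j.
    by apply: val_inj => /=; have := ltn_ord i; have := ltn_ord j; lia.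
  exists (\matrix_(i, j) (distprod A B i j)%:R) => [|v i vi].
    by apply: is_approx_map => i j; rewrite [X in ratr X]mxE.
  rewrite algP //; apply/rowP => j; rewrite [LHS]mxE [RHS]mxE [RHS]mxE.
  have [k ->] := distprod_attained A B i j (leq_ltn_trans (leq0n _) (ltn_ord j)).
  by rewrite -(pad_rowsE A _ vi) !mxE (eq_ord k j) (eq_ord (posB v) j).
have n0 : (0 < n)%N by apply: ltnW.
have [a [m [h [D [s [g [[h0 nmh rah] [m2 h2 D0 szs] sP De]]]]]]] :=
  cP n 'Z_n.+1 n0.
pose Q := (Num.trunc (4 * rho)).+1; pose tau := (up_log 2 M).+1.
have le_b : (n * n <= 2 ^ (2 * up_log 2 n))%N.
  by rewrite mul2n -addnn expnD leq_mul ?up_logP.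
have [alg algb algP] := computable_alg
  (computable_approx_row M Q tau n1 le_b h0 nmh m2 h2 szs D0 c0 sP).
exists alg, (16 * load (layer Q tau) D c).+1; split=> //.
  have -> : load (layer Q tau) D c = (2 * (c * D * (tau * (2 * Q).+1)))%N.
    by rewrite /load card_prod !card_ord.
  have Q_le : Q%:R <= 5 * rho :> R.
    rewrite /Q -natr1; have : (Num.trunc (4 * rho))%:R <= 4 * rho.
      by rewrite -truncn_ge_nat //; lra.
    by lra.
  set W := (c * D * _)%N.
  have W0 : (0 < W)%N by rewrite !muln_gt0 c0 D0.
  apply: le_trans (_ : (33 * W)%:R <= _); first by rewrite ler_nat; lia.
  apply: le_trans (_ : 33 * (c%:R * (20 * n%:R `^ (1 - 2 / omega r'))
      * ((3 * ln M%:R / ln 2) * (11 * rho))) <= _); last first.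
    by rewrite /K; lra.
  rewrite natrM ler_pM2l // /W !natrM; apply: ler_pM; rewrite ?mulr_ge0 ?ler0n //.
    by apply: ler_pM; rewrite ?ler0n.
  apply: ler_pM; rewrite ?ler0n // ?ler_pdivlMr ?scale_count_le //.
  by rewrite -natr1 natrM; lra.
move=> A B posA posB bA bB hA hB.
have [eA eB] := row_matrix_distribute (pad_rows A) B bA bB.
have le_rn : (npow n r <= n)%N.
  apply: npow_le; rewrite -[X in _ <= X]powRr1 ?ler0n //.
  by apply: ler_powR; rewrite ?ler1n.
exists (\matrix_(i, j)
    approx_row M Q tau (a * h) (pad_rows A) B (widen_ord le_rn i) 0 j).
  apply: is_approx_map => i j; rewrite [X in ratr X]mxE [X in ratr X]mxE.
  apply: scaled_min_approx => //.
    by apply: ltW; rewrite -truncn_le_nat.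
  (* The rows of [A] come first in [pad_rows A], and [npow n r <= a * h] ensures that none of them
     is cut off. *)
  move=> l; rewrite layer_count_neq0 //=; last by apply: leq_trans rah.
  by apply: eq_existsb => k; rewrite (@pad_rowsE _ _ A i).
move=> v i vi; rewrite algP /=; last by split; apply: bij_inj.
rewrite eA eB; apply/rowP => j; rewrite !mxE /=.
by have -> : posA v = widen_ord le_rn i by apply: val_inj.
Qed.
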